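(* Let $\mu=\mathfrak C+l_1+l_2$ be a curved symmetric differential graded Lie algebra structure on a graded vector space $E=\oplus_{i\in\mathbb Z}E_i$ and let $\pi\in E_0$. Then $\mathcal N=\mathrm{Id}_E+\pi$ is a Nijenhuis vector valued form (with curvature $\pi$) with respect to $\mu$ with square $\mathrm{Id}_E+\pi$ if and only if $\pi$ is a Maurer-Cartan element, i.e. $(l_1(\pi)-\mathfrak C)-\frac12 l_2(\pi,\pi)=0$. In this case, the deformed structure $[\mathcal N,\mu]_{_{RN}}$ is the curved symmetric differential graded Lie algebra structure $(l_1(\pi)-\mathfrak C)+l_2(\pi,\cdot)+l_2$ on $E$.
   Context: Base field $\mathbb K=\mathbb R$ or $\mathbb C$; $|X|$ is the degree of a homogeneous $X\in E$. A symmetric vector valued $k$-form ($k\ge 0$) is a graded symmetric $k$-linear map $K:E\times\cdots\times E\to E$ (for $k=0$, an element of $E$). It has degree $\bar K$ if $|K(X_1,\dots,X_k)|=|X_1|+\cdots+|X_k|+\bar K$ (for $X\in E$, $\bar X=|X|$). A symmetric vector valued form is a formal sum $\sum_{k\ge0}K_k$ of vector valued $k$-forms; it has degree $d$ if all $K_k$ do. Insertion: for a $k$-form $K$ and an $l$-form $L$ with $l\ge1$, $$\iota_KL(X_1,\dots,X_{k+l-1})=\sum_{\sigma\in Sh(k,l-1)}\epsilon(\sigma)L(K(X_{\sigma(1)},\dots,X_{\sigma(k)}),X_{\sigma(k+1)},\dots,X_{\sigma(k+l-1)}),$$ where $Sh(k,l-1)$ is the set of $(k,l-1)$-unshuffles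 and $\epsilon(\sigma)$ is the Koszul sign; $\iota_KL=0$ if $L\in E$; and $\iota_XK=K(X,\cdot,\dots,\cdot)$ for $X\in E$. Richardson-Nijenhuis bracket: $[K,L]_{_{RN}}=\iota_KL-(-1)^{\bar K\bar L}\iota_LK$, extended to formal sums. A curved symmetric differential graded Lie algebra structure is a sum $\mathfrak C+l_1+l_2$ with $\mathfrak C\in E_1$ (the curvature, possibly zero), $l_1$ a linear map of degree $1$, and $l_2$ a graded symmetric bilinear map of degree $1$, such that for all homogeneous $X,Y,Z$: $l_1(\mathfrak C)=0$; $l_2(\mathfrak C,X)+l_1(l_1(X))=0$; $l_1(l_2(X,Y))+l_2(l_1(X),Y)+(-1)^{|X|}l_2(X,l_1(Y))=0$; and $l_2(l_2(X,Y),Z)+(-1)^{|Y||Z|}l_2(l_2(X,Z),Y)+(-1)^{|X|(|Y|+|Z|)}l_2(l_2(Y,Z),X)=0$. For a form $\mu$ of degree $1$, a form $\mathcal N$ of degree zero is Nijenhuis with respect to $\mu$ with square $\mathcal K$ if $\mathcal K$ is a vector valued form of degree zero with $[\mathcal N,[\mathcal N,\mu]_{_{RN}}]_{_{RN}}=[\mathcal K,\mu]_{_{RN}}$ and $[\mathcal N,\mathcal K]_{_{RN}}=0$. ''With curvature'' means that $\mathcal N$ has a vector valued $0$-form component. *)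

(* Defs.v *)
From HB Require Import structures.
From mathcomp Require Import all_boot all_order all_algebra all_fingroup.
From mathcomp Require Import boolp classical_sets functions cardinality fsbigop.
From mathcomp Require Import reals complex.

Set Implicit Arguments.
Unset Strict Implicit.
Unset Printing Implicit Defensive.

Import Order.TTheory GRing.Theory Num.Theory.

Local Open Scope classical_set_scope.
Local Open Scope ring_scope.

Section GradedSpace.
Variables (K : fieldType) (V : lmodType K).
Implicit Types (E : int -> set V) (v : V).

(* [f i] is the component of degree [i] of [v]. *)
Definition decomposition E v (f : int -> V) :=
  [/\ forall i, E i (f i),
      finite_set [set i | f i != 0]
    & v = \sum_(i \in [set: int]) f i].

Definition grading E :=
  (forall i, E i 0 /\ forall a x y, E i x -> E i y -> E i (a *: x + y)) /\
  (forall v, exists! f, decomposition E v f).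

Definition component E v : int -> V :=
  xget (fun=> 0) [set f | decomposition E v f].

(* The Koszul sign of s for arguments X_0, ..., X_(n-1) of degrees d:           *)
(* X_(s 0) . ... . X_(s (n-1)) = koszul d s *: X_0 . ... . X_(n-1)              *)
(* in the graded symmetric algebra.                                             *)
Definition koszul n (d : 'I_n -> int) (s : 'S_n) : K :=
  \prod_(i < n) \prod_(j < n | (i < j)%N && (s j < s i)%N)
    (-1) ^ (d (s i) * d (s j)).

Definition unshuffle k l (s : 'S_(k + l)) :=
  [forall i : 'I_k, forall j : 'I_k,
     (i < j)%N ==> (s (lshift l i) < s (lshift l j))%N] &&
  [forall i : 'I_l, forall j : 'I_l,
     (i < j)%N ==> (s (rshift k i) < s (rshift k j))%N].

Definition kmap k := ('I_k -> V) -> V.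

Definition multilinear k (F : kmap k) :=
  forall (X : 'I_k -> V) i a x y,
    F [eta X with i |-> a *: x + y] =
    a *: F [eta X with i |-> x] + F [eta X with i |-> y].

Definition graded_symmetric E k (F : kmap k) :=
  forall (d : 'I_k -> int) (X : 'I_k -> V) (s : 'S_k),
    (forall i, E (d i) (X i)) -> F (X \o s) = koszul d s *: F X.

(* Formal sums: F k is the k-linear term. *)
Definition formal_sum := forall k, kmap k.

Definition symmetric_form E (F : formal_sum) :=
  forall k, multilinear (F k) /\ graded_symmetric E (F k).

Definition has_degree E (n : int) (F : formal_sum) :=
  forall k (d : 'I_k -> int) (X : 'I_k -> V),
    (forall i, E (d i) (X i)) -> E (\sum_(i < k) d i + n) (F k X).

Definition vcons l (x : V) (Y : 'I_l -> V) : 'I_l.+1 -> V :=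
  fun i => oapp Y x (unlift ord0 i).

(* The Koszul signs only make sense on homogeneous arguments, so each argument  *)
(* is split into its homogeneous components: d assigns a degree to each of them.*)
(* When F and G are multilinear only finitely many d contribute.                *)
Definition insertion_kmap E k l (F : kmap k) (G : kmap l.+1) : kmap (k + l) :=
  fun X => \sum_(d \in [set: {ffun 'I_(k + l) -> int}])
    let Y i := component E (X i) (d i) in
    \sum_(s : 'S_(k + l) | unshuffle s)
      koszul d s *: G (vcons (F (fun i => Y (s (lshift l i))))
                             (fun j => Y (s (rshift k j)))).

(* The term of arity n collects the insertions of F k into G l with             *)
(* k + l - 1 = n and l >= 1; G 0 never contributes.                             *)
Definition insertion E (F G : formal_sum) : formal_sum :=
  fun n X => \sum_(k < n.+1)
    insertion_kmap E (F k) (G (n - k).+1)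
      (fun i => X (cast_ord (subnKC (leq_ord k)) i)).

Arguments insertion : clear implicits.

(* The degrees p of F and q of G are arguments, since they are not determined   *)
(* by the forms when these vanish.                                              *)
Definition RN_bracket E (p q : int) (F G : formal_sum) : formal_sum :=
  fun n X => insertion E F G n X - (-1) ^ (p * q) *: insertion E G F n X.

Definition sum012 (c : V) (f : V -> V) (g : V -> V -> V) : formal_sum :=
  fun k => match k return kmap k with
           | 0 => fun=> c
           | 1 => fun X => f (X ord0)
           | 2 => fun X => g (X ord0) (X ord_max)
           | _ => fun=> 0
           end.

Definition zero_form : formal_sum := fun _ _ => 0.

Definition nijenhuis E (N mu S : formal_sum) :=
  [/\ symmetric_form E mu /\ has_degree E 1 mu,
      symmetric_form E N /\ has_degree E 0 N,
      symmetric_form E S /\ has_degree E 0 S,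
      RN_bracket E 0 1 N (RN_bracket E 0 1 N mu) = RN_bracket E 0 1 S mu
    & RN_bracket E 0 0 N S = zero_form].

Definition curvature (N : formal_sum) : V := N 0 (fun=> 0).

Record curved_sdgla E (c : V) (l1 : V -> V) (l2 : V -> V -> V) : Prop := {
  curv_deg : E 1 c;
  l1_linear : linear l1;
  l1_deg : forall i x, E i x -> E (i + 1) (l1 x);
  l2_linearl : forall y, linear (l2^~ y);
  l2_linearr : forall x, linear (l2 x);
  l2_deg : forall i j x y, E i x -> E j y -> E (i + j + 1) (l2 x y);
  l2_sym : forall i j x y, E i x -> E j y ->
    l2 x y = (-1) ^ (i * j) *: l2 y x;
  l1_curv : l1 c = 0;
  l1_square : forall i x, E i x -> l2 c x + l1 (l1 x) = 0;
  l1_l2 : forall i j x y, E i x -> E j y ->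
    l1 (l2 x y) + l2 (l1 x) y + (-1) ^ i *: l2 x (l1 y) = 0;
  l2_jacobi : forall i j k x y z, E i x -> E j y -> E k z ->
    l2 (l2 x y) z + (-1) ^ (j * k) *: l2 (l2 x z) y
      + (-1) ^ (i * (j + k)) *: l2 (l2 y z) x = 0
}.

Definition maurer_cartan (c : V) (l1 : V -> V) (l2 : V -> V -> V) (x : V) :=
  (l1 x - c) - 2^-1 *: l2 x x = 0.

End GradedSpace.

Arguments insertion {K V} E F G k X.
Arguments RN_bracket {K V} E p q F G k X.
Arguments sum012 {K V} c f g k X.
Arguments zero_form {K V} k X.

(* Main.v *)
From HB Require Import structures.
Require Import Defs.
From mathcomp Require Import all_boot all_order all_algebra all_fingroup.
From mathcomp Require Import boolp classical_sets functions cardinality fsbigop.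
From mathcomp Require Import reals complex.

(* For any form F = a + f + g with a in V, f linear and g bilinear, [N, F] is   *)
(* (f p - a) + g(p, .) + g: inserting the identity into an n-form multiplies it *)
(* by n, and inserting F into Id_E gives F back. Hence [N, N] = 0, while        *)
(* [N, mu] and [N, [N, mu]] can differ only in arity 0, where equality reads    *)
(* l2 p p = 2 (l1 p - c). The deformed structure equations are then the Jacobi  *)
(* identity with p among the arguments; [l2 p (l2 p p) = 0] uses that 3 is      *)
(* invertible.                                                                  *)

Set Implicit Arguments.
Unset Strict Implicit.
Unset Printing Implicit Defensive.

Import Order.TTheory GRing.Theory Num.Theory.

Local Open Scope classical_set_scope.
Local Open Scope ring_scope.

(** Everything rests on one formula, [RN_bracket_idD]: bracketing [Id + p] with [a + f + g] gives
    [(f p - a) + g p + g]. The identity multiplies each term by its arity, the reverse insertion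
    subtracts the term once, and [p] fills one slot. Applied to [mu] and then to the result, the
    formula changes only the curvature at the second step, from [l1 p - c] to [l2 p p - (l1 p - c)];
    their equality is the Maurer-Cartan equation. Applied to [N] itself it gives curvature
    [p - p = 0]. Insertions are defined through homogeneous components, so [component_expansion] is
    what evaluates them on arbitrary arguments; [insertion_kmap0l], [insertion_kmapr0] and
    [insertion_kmap_id] treat the nonzero cases. The deformed structure equations are the Jacobi
    identity with [p] in three, two and one slots. *)

(** * Unshuffles with an empty block *)

(** The image under [s] of the sorted enumeration is sorted with the same elements, and a strictly
    sorted list is determined by its elements. *)
Lemma increasing_perm1 n (s : 'S_n) :
  (forall i j : 'I_n, (i < j)%N -> (s i < s j)%N) -> s = 1%g.
Proof.
move=> s_mono; apply/permP => i; rewrite perm1.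
pose lt_ord := [rel i j : 'I_n | (i < j)%N].
have enum_sorted : sorted lt_ord (enum 'I_n).
  rewrite -(sorted_map (f := val) (e' := ltn)) val_enum_ord.
  exact: iota_ltn_sorted.
suff /eq_in_map/(_ i) -> : [seq s j | j <- enum 'I_n] = [seq id j | j <- enum 'I_n].
- by [].
- by rewrite mem_enum.
rewrite map_id; apply: (@irr_sorted_eq _ lt_ord) => //.
- by move=> x y z /=; apply: ltn_trans.
- by move=> x /=; apply: ltnn.
- exact: homo_sorted enum_sorted.
- by move=> j; rewrite mem_enum -[j](permKV s) map_f ?mem_enum.
Qed.

Lemma unshuffle1 k l : unshuffle (1%g : 'S_(k + l)).
Proof.
by apply/andP; split; apply/forallP => i; apply/forallP => j;
  apply/implyP => ij; rewrite !perm1 //= ltn_add2l.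
Qed.

(** When one block is empty the other covers all positions, so the insertion sum has a single
    term. *)
Lemma unshuffle0l l (s : 'S_(0 + l)) : unshuffle s = (s == 1%g).
Proof.
apply/idP/eqP => [/andP [_ /forallP s_mono]|->]; last exact: unshuffle1.
apply: increasing_perm1 => i j ij.
have := forallP (s_mono i) j; rewrite ij.
by rewrite !(_ : forall k, rshift 0 k = k) // => k; apply: val_inj.
Qed.

Lemma unshuffler0 k (s : 'S_(k + 0)) : unshuffle s = (s == 1%g).
Proof.
apply/idP/eqP => [/andP [/forallP s_mono _]|->]; last exact: unshuffle1.
apply: increasing_perm1 => i j.
have [i' ->|[]//] := split_ordP i; have [j' ->|[]//] := split_ordP j.
by move: (forallP (s_mono i') j') => /implyP.
Qed.

(** * Finitely supported sums and multilinear expansion *)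

(** Turns sums over all degrees, or over all degree assignments, into sums over a finite type that
    covers the support. *)
Lemma fsum_finType (U : nmodType) (T : choiceType) (J : finType) (h : J -> T)
    (phi : T -> U) :
  injective h -> (forall t, phi t != 0 -> exists j, h j = t) ->
  \sum_(t \in [set: T]) phi t = \sum_j phi (h j).
Proof.
move=> h_inj h_supp.
rewrite (@fsbigE _ _ _ _ setT [seq h j | j <- enum J]) //; last 2 first.
- by rewrite map_inj_uniq // enum_uniq.
- move=> t _; apply: contraNeq => /h_supp [j <-].
  by rewrite map_f ?mem_enum.
by rewrite big_map big_enum_cond; apply: eq_bigl => j; exact: mem_set.
Qed.

Lemma sum_ffunS (U : nmodType) (J : finType) n
    (phi : ('I_n.+1 -> J) -> U) :
  \sum_(d : {ffun 'I_n.+1 -> J}) phi d =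
  \sum_(a : J) \sum_(e : {ffun 'I_n -> J}) phi (fun i => oapp e a (unlift ord0 i)).
Proof.
rewrite pair_big /=.
pose split_ffun (d : {ffun 'I_n.+1 -> J}) := (d ord0, [ffun i => d (lift ord0 i)]).
pose cons_ffun (u : J * {ffun 'I_n -> J}) :=
  [ffun i : 'I_n.+1 => oapp u.2 u.1 (unlift ord0 i)].
rewrite (reindex cons_ffun) /=; last first.
  exists split_ffun.
    move=> [a e] _; rewrite /split_ffun /cons_ffun ffunE unlift_none /=.
    by congr pair; apply/ffunP => i; rewrite !ffunE liftK.
  move=> d _; apply/ffunP => i; rewrite ffunE /=.
  by case: unliftP => [j|] -> //=; rewrite ffunE.
by apply: eq_bigr => u _; congr phi; apply/funext => i; rewrite ffunE.
Qed.

Section Multilinear.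
Variables (K : fieldType) (V : lmodType K).

Lemma vcons_eta n (X : 'I_n.+1 -> V) : X = vcons (X ord0) (X \o lift ord0).
Proof. by apply/funext => i; rewrite /vcons; case: unliftP => [j|] ->. Qed.

Lemma vcons0 l x (Y : 'I_l -> V) : vcons x Y ord0 = x.
Proof. by rewrite /vcons unlift_none. Qed.

Lemma multilinear_vconsr l (G : kmap V l.+1) x :
  multilinear G -> multilinear (fun Y => G (vcons x Y)).
Proof.
move=> G_lin Y i a u v.
have vcons_with z : vcons x [eta Y with i |-> z] =
    [eta vcons x Y with lift ord0 i |-> z].
  apply/funext => j; rewrite /vcons /=.
  by case: unliftP => [k|] -> /=; rewrite ?(inj_eq lift_inj).
by rewrite !vcons_with.
Qed.

Lemma multilinear_vconsl l (G : kmap V l.+1) Y :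
  multilinear G -> linear (fun x => G (vcons x Y)).
Proof.
move=> G_lin a u v.
have vcons_with z : vcons z Y = [eta vcons 0 Y with ord0 |-> z].
  by apply/funext => j; rewrite /vcons /=; case: unliftP => [k|] ->.
by rewrite vcons_with G_lin -!vcons_with.
Qed.

(** Induction on the arity: linearity in the first slot peels off one sum, and [sum_ffunS] splits
    the index functions accordingly. *)
Lemma multilinear_sum n (G : kmap V n) (J : finType) (X : 'I_n -> J -> V) :
  multilinear G ->
  G (fun i => \sum_j X i j) = \sum_(d : {ffun 'I_n -> J}) G (fun i => X i (d i)).
Proof.
elim: n => [|n IHn] in G X * => G_lin.
  pose d0 := [ffun i : 'I_0 => False_rect J (notF (ltn_ord i))].
  rewrite (bigD1 d0) //= big1 ?addr0 => [|d /eqP []]; last first.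
    by apply/ffunP => -[].
  by congr G; apply/funext => -[].
pose H Y := GRing.isLinear.Build _ _ _ _ _ (multilinear_vconsl Y G_lin).
pose HL Y : {linear V -> V} := HB.pack (fun x => G (vcons x Y)) (H Y).
rewrite [in LHS](vcons_eta (fun i => \sum_j X i j)).
rewrite [LHS](raddf_sum (HL _)) /=.
rewrite (sum_ffunS (fun d => G (fun i => X i (d i)))).
apply: eq_bigr => a _ /=.
rewrite (IHn _ (fun i => X (lift ord0 i)) (multilinear_vconsr _ G_lin)).
apply: eq_bigr => e _; congr G.
rewrite [RHS](vcons_eta (fun i => X i (oapp e a (unlift ord0 i)))).
rewrite unlift_none /=; congr vcons; apply/funext => i /=.
by rewrite liftK.
Qed.

Lemma signz_sqr (m : int) : (-1) ^ m * (-1) ^ m = 1 :> K.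
Proof. by rewrite -expfzMl mulrNN mulr1 exp1rz. Qed.

Lemma koszul1 n (d : 'I_n -> int) : koszul K d 1%g = 1.
Proof.
rewrite /koszul big1 // => i _; rewrite big1 // => j /andP [].
by rewrite !perm1 => ij ji; move: (ltn_trans ij ji); rewrite ltnn.
Qed.

Lemma koszul_sqr n (d : 'I_n -> int) (s : 'S_n) : koszul K d s * koszul K d s = 1.
Proof.
rewrite /koszul -big_split big1 //= => i _; rewrite -big_split big1 //= => j _.
exact: signz_sqr.
Qed.

End Multilinear.

(** * Homogeneous components *)

Section Components.
Variables (K : fieldType) (V : lmodType K) (E : int -> set V).
Hypothesis gradedE : grading E.

Lemma componentP v : decomposition E v (component E v).
Proof.
apply: (@xgetPex _ _ [set f | decomposition E v f]).
by have [_ /(_ v) [f [fP _]]] := gradedE; exists f.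
Qed.

Lemma component_deg v i : E i (component E v i).
Proof. by have [] := componentP v. Qed.

Lemma graded0 i : E i 0.
Proof. by have [/(_ i) []] := gradedE. Qed.

Lemma gradedZD i a x y : E i x -> E i y -> E i (a *: x + y).
Proof. by have [/(_ i) [_ EP] _] := gradedE; apply: EP. Qed.

Lemma multilinear0 n (G : kmap V n) X i : multilinear G -> X i = 0 -> G X = 0.
Proof.
move=> G_lin Xi0.
have XE : X = [eta X with i |-> 0].
  by apply/funext => j /=; case: eqP => // ->.
(* Linearity in slot [i] at [1 *: 0 + 0] reads [G X = G X + G X]. *)
have /eqP := G_lin X i 1 0 0; rewrite !scale1r addr0 -XE.
by rewrite -subr_eq subrr => /eqP.
Qed.

(** The right side has the same index set as [insertion_kmap], so an insertion can be computed by
    comparing summands, whose arguments are homogeneous. *)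
Lemma component_expansion n (G : kmap V n) (X : 'I_n -> V) : multilinear G ->
  G X = \sum_(d \in [set: {ffun 'I_n -> int}])
          G (fun i => component E (X i) (d i)).
Proof.
move=> G_lin.
(* A single finite list of degrees serves all the arguments at once. *)
have [r r_supp] : exists r : seq int,
    forall i a, component E (X i) a != 0 -> a \in r.
  have : finite_set (\bigcup_(i in [set: 'I_n])
                       [set a | component E (X i) a != 0]).
    apply: bigcup_finite => // i _.
    by have [] := componentP (X i).
  case/finite_seqP => r rE; exists r => i a Xia.
  have : [set` r] a by rewrite -rE; exists i.
  by [].
transitivity (G (fun i => \sum_(a : seq_sub r) component E (X i) (val a))).
  congr G.
  apply/funext => i; have [_ _ {1}->] := componentP (X i).
  apply: fsum_finType => [|a /r_supp ar]; first exact: val_inj.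
  by exists (SeqSub ar).
rewrite (multilinear_sum (fun i (a : seq_sub r) => component E (X i) (val a)) G_lin).
pose h (e : {ffun 'I_n -> seq_sub r}) := [ffun i => val (e i)].
rewrite (fsum_finType (h := h)).
- by apply: eq_bigr => e _; congr G; apply/funext => i; rewrite ffunE.
- move=> e1 e2 /ffunP eqh; apply/ffunP => i; apply: val_inj.
  by have := eqh i; rewrite !ffunE.
move=> d Gd0.
have dr i : d i \in r.
  apply: (r_supp i); apply: contraNneq Gd0 => Xi0.
  exact/eqP/(multilinear0 G_lin Xi0).
exists [ffun i => SeqSub (dr i)].
by apply/ffunP => i; rewrite !ffunE.
Qed.

(** * Evaluation of insertions *)

Lemma insertion_kmap_eq0 k l (F : kmap V k) (G : kmap V l.+1) X :
  multilinear G -> (forall Y, F Y = 0) \/ (forall Y, G Y = 0) ->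
  insertion_kmap E F G X = 0.
Proof.
move=> G_lin FG0; rewrite /insertion_kmap fsbig1 // => d _.
rewrite big1 // => s _; case: FG0 => [F0|->]; last by rewrite scaler0.
by rewrite (multilinear0 (i := ord0) G_lin) ?scaler0 // F0 vcons0.
Qed.

Lemma insertion_kmap0l l (F : kmap V 0) (G : kmap V l.+1) (X : 'I_(0 + l) -> V) :
  multilinear G -> insertion_kmap E F G X = G (vcons (F (fun=> 0)) X).
Proof.
move=> G_lin.
rewrite [RHS](component_expansion X (multilinear_vconsr (F (fun=> 0)) G_lin)).
apply: eq_fsbigr => d _ /=.
rewrite (big_pred1 1%g) => [|s]; last exact: unshuffle0l.
rewrite koszul1 scale1r; congr (G (vcons (F _) _)); apply/funext => i.
  by case: i.
by rewrite perm1 (_ : rshift 0 i = i) //; apply: val_inj.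
Qed.

Lemma insertion_kmapr0 k (F : kmap V k) (G : kmap V 1) (X : 'I_(k + 0) -> V) :
  multilinear F -> multilinear G ->
  insertion_kmap E F G X = G (fun=> F (fun i => X (lshift 0 i))).
Proof.
move=> F_lin G_lin.
have vcons1 x (Y : 'I_0 -> V) : vcons x Y = fun=> x.
  by apply/funext => i; rewrite ord1 vcons0.
(* The composite is typed in arity [k + 0] so that its component expansion has the index set of the
   insertion. *)
have GF_lin : @multilinear _ _ (k + 0) (fun Y => G (fun=> F (fun i => Y (lshift 0 i)))).
  move=> Y i a x y.
  have [j ->|[]//] := split_ordP i.
  have lshift_with z : (fun i' => [eta Y with lshift 0 j |-> z] (lshift 0 i')) =
      [eta (fun i' => Y (lshift 0 i')) with j |-> z].
    by apply/funext => i' /=; rewrite (inj_eq (@lshift_inj _ _)).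
  rewrite !lshift_with F_lin -!(vcons1 _ (fun=> 0)).
  exact: (multilinear_vconsl _ G_lin).
rewrite [RHS](component_expansion X GF_lin); apply: eq_fsbigr => d _ /=.
rewrite (big_pred1 1%g) => [|s]; last exact: unshuffler0.
rewrite koszul1 scale1r vcons1; congr G; apply/funext => _.
by congr F; apply/funext => i; rewrite perm1.
Qed.

(** Both permutations of two arguments are unshuffles. Graded symmetry of [G] produces a second copy
    of the Koszul sign, the signs square to one, and the two terms agree. *)
Lemma insertion_kmap_id (G : kmap V 2) (X : 'I_(1 + 1) -> V) :
  multilinear G -> graded_symmetric E G ->
  insertion_kmap E (fun Y : 'I_1 -> V => Y ord0) G X = G X *+ 2.
Proof.
move=> G_lin G_sym.
have G2_lin : multilinear (fun Y => G Y *+ 2).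
  by move=> Y i a x y; rewrite G_lin mulrnDl scalerMnr.
rewrite [RHS](component_expansion X G2_lin); apply: eq_fsbigr => d _ /=.
rewrite (eq_bigl predT) => [|s]; last first.
  by apply/andP; split; apply/forallP => i; apply/forallP => j; rewrite !ord1.
rewrite (eq_bigr (fun=> G (fun i => component E (X i) (d i)))) => [|s _].
  by rewrite sumr_const card_Sn.
rewrite -[RHS]scale1r -(koszul_sqr K d s) -scalerA; congr (_ *: _).
rewrite -(G_sym d) => [|i]; last exact: component_deg.
congr G; rewrite [RHS]vcons_eta; congr vcons => /=.
  by rewrite (_ : lshift 1 ord0 = ord0) //; apply: val_inj.
apply/funext => j /=.
by rewrite (_ : rshift 1 j = lift ord0 j) //; apply: val_inj.
Qed.

Lemma insertion0 (F G : formal_sum V) (X : 'I_0 -> V) :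
  insertion E F G 0 X = insertion_kmap E (F 0) (G 1) (X : 'I_(0 + 0) -> V).
Proof.
rewrite /insertion big_ord_recl big_ord0 addr0.
by congr insertion_kmap; apply/funext => -[].
Qed.

Lemma insertion1 (F G : formal_sum V) (X : 'I_1 -> V) :
  insertion E F G 1 X = insertion_kmap E (F 0) (G 2) (X : 'I_(0 + 1) -> V)
    + insertion_kmap E (F 1) (G 1) (X : 'I_(1 + 0) -> V).
Proof.
rewrite /insertion !big_ord_recl big_ord0 addr0.
by congr (_ + _); congr insertion_kmap;
  apply/funext => i; congr X; apply: val_inj.
Qed.

Lemma insertion2 (F G : formal_sum V) (X : 'I_2 -> V) :
  insertion E F G 2 X = insertion_kmap E (F 0) (G 3) (X : 'I_(0 + 2) -> V)
    + insertion_kmap E (F 1) (G 2) (X : 'I_(1 + 1) -> V)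
    + insertion_kmap E (F 2) (G 1) (X : 'I_(2 + 0) -> V).
Proof.
rewrite /insertion !big_ord_recl big_ord0 addr0 addrA.
by congr (_ + _ + _); congr insertion_kmap;
  apply/funext => i; congr X; apply: val_inj.
Qed.

End Components.

(** * Forms with terms of arity at most two and their brackets with [Id + p] *)

Section LowArityForms.
Variables (K : fieldType) (V : lmodType K) (E : int -> set V).
Hypothesis gradedE : grading E.
Implicit Types (a p : V) (f : V -> V) (g : V -> V -> V).

Lemma sum012_multilinear a f g k :
  linear f -> (forall y, linear (g^~ y)) -> (forall x, linear (g x)) ->
  multilinear (sum012 a f g k).
Proof.
move=> f_lin gl_lin gr_lin; case: k => [|[|[|k]]] X i b x y /=.
- by case: i.
- by rewrite (ord1 i) /=; apply: f_lin.
- by case: i => [[|[|//]] ?]; [apply: gl_lin | apply: gr_lin].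
- by rewrite scaler0 addr0.
Qed.

Lemma sum012_graded_symmetric a f g k :
  (forall i j x y, E i x -> E j y -> g x y = (-1) ^ (i * j) *: g y x) ->
  graded_symmetric E (sum012 a f g k).
Proof.
move=> g_sym d X s Xd.
case: k => [|[|[|k]]] in d X s Xd *; last by rewrite /= scaler0.
- by rewrite (@increasing_perm1 0 s) ?koszul1 ?scale1r // => -[].
- rewrite (@increasing_perm1 1 s) => [|i j]; last by rewrite !ord1.
  by rewrite koszul1 scale1r /= perm1.
(* In arity two, [s] is either the identity or the transposition; the latter has a single inversion,
   which gives the whole sign. *)
have [s0|s0] := eqVneq (s ord0) ord0.
  have s1 : s ord_max = ord_max.
    have : s ord_max != s ord0 by rewrite (inj_eq perm_inj).
    by rewrite s0; case: (s ord_max) => [[|[|//]] ?] // _; apply: val_inj.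
  have -> : s = 1%g.
    apply/permP => i; rewrite perm1.
    case: (unliftP ord0 i) => [j|] ->; rewrite // ord1.
    by rewrite (_ : lift _ _ = ord_max) //; apply: val_inj.
  by rewrite koszul1 scale1r /= !perm1.
have s0' : s ord0 = ord_max.
  by move: s0; case: (s ord0) => [[|[|//]] ?] // _; apply: val_inj.
have s1 : s ord_max = ord0.
  have : s ord_max != s ord0 by rewrite (inj_eq perm_inj).
  by rewrite s0'; case: (s ord_max) => [[|[|//]] ?] // _; apply: val_inj.
have -> : koszul K d s = (-1) ^ (d ord_max * d ord0).
  have lift0 : lift ord0 ord0 = ord_max :> 'I_2 by apply: val_inj.
  rewrite /koszul; under eq_bigr do rewrite big_mkcond.
  rewrite !big_ord_recl !big_ord0 /= !lift0 s0' s1 /=.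
  by rewrite !mul1r !mulr1.
by rewrite /= s0' s1; apply: g_sym.
Qed.

Lemma sum012_symmetric_form a f g :
  linear f -> (forall y, linear (g^~ y)) -> (forall x, linear (g x)) ->
  (forall i j x y, E i x -> E j y -> g x y = (-1) ^ (i * j) *: g y x) ->
  Defs.symmetric_form E (sum012 a f g).
Proof.
move=> f_lin gl_lin gr_lin g_sym k; split; first exact: sum012_multilinear.
exact: sum012_graded_symmetric.
Qed.

Lemma sum012_degree n a f g :
  E n a -> (forall i x, E i x -> E (i + n) (f x)) ->
  (forall i j x y, E i x -> E j y -> E (i + j + n) (g x y)) ->
  has_degree E n (sum012 a f g).
Proof.
move=> aE fE gE [|[|[|k]]] d X Xd /=; last exact: graded0.
- by rewrite big_ord0 add0r.
- by rewrite big_ord1; apply: fE.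
- rewrite big_ord_recl big_ord1 (_ : lift ord0 ord0 = ord_max); last exact: val_inj.
  exact: gE.
Qed.

Lemma sum012_idD_symmetric_form p : Defs.symmetric_form E (sum012 p id (fun _ _ => 0)).
Proof.
have zero_lin : linear (fun=> 0 : V) by move=> b x y; rewrite scaler0 addr0.
by apply: sum012_symmetric_form => // *; rewrite scaler0.
Qed.

(** Arity [n] collects [p] inserted into the term of arity [n.+1] and the identity inserted into the
    term of arity [n]; the latter counts [n] times. *)
Lemma insertion_idD p a f g n (X : 'I_n -> V) :
  Defs.symmetric_form E (sum012 a f g) ->
  insertion E (sum012 p id (fun _ _ => 0)) (sum012 a f g) n X =
  sum012 (f p) (fun x => g p x + f x) (fun x y => g x y *+ 2) n X.
Proof.
set N := sum012 p _ _; set F := sum012 a f g => F_form.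
have F_lin k : multilinear (F k) by have [] := F_form k.
have N_lin k : multilinear (N k) by have [] := sum012_idD_symmetric_form p k.
have vcons1 x (Y : 'I_1 -> V) : vcons x Y ord_max = Y ord0.
  by rewrite (_ : ord_max = lift ord0 ord0) ?/vcons ?liftK //; apply: val_inj.
case: n X => [|[|[|n]]] X.
- by rewrite insertion0 insertion_kmap0l //= vcons0.
- rewrite insertion1 insertion_kmap0l // insertion_kmapr0 //=.
  rewrite vcons0 vcons1.
  by rewrite (_ : lshift 0 ord0 = ord0) //; apply: val_inj.
- rewrite insertion2 insertion_kmap0l // (@insertion_kmap_id _ _ _ _ (F 2)) //.
    by rewrite insertion_kmap_eq0 /= ?add0r ?addr0 //; left.
  by have [] := F_form 2.
- have N0 k Y : N k.+2 Y = 0 by case: k Y.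
  rewrite /insertion big1 // => -[[|[|k]] ?] _;
    apply: insertion_kmap_eq0 => //; [by right|by right|by left; apply: N0].
Qed.

(** The identity is the only nonzero term of positive arity in [Id + p], so only the top summand
    [k = n] survives. *)
Lemma insertion_into_idD p a f g n (X : 'I_n -> V) :
  Defs.symmetric_form E (sum012 a f g) ->
  insertion E (sum012 a f g) (sum012 p id (fun _ _ => 0)) n X =
  sum012 a f g n X.
Proof.
set N := sum012 p _ _; set F := sum012 a f g => F_form.
have F_lin k : multilinear (F k) by have [] := F_form k.
have N_lin k : multilinear (N k) by have [] := sum012_idD_symmetric_form p k.
case: n X => [|[|[|n]]] X.
- by rewrite insertion0 insertion_kmap0l //= vcons0.
- rewrite insertion1 insertion_kmap_eq0 ?add0r //; last by right.
  rewrite insertion_kmapr0 //=.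
  by rewrite (_ : lshift 0 ord0 = ord0) //; apply: val_inj.
- rewrite insertion2 2?insertion_kmap_eq0 ?add0r //; [|by right|by right].
  rewrite insertion_kmapr0 //=.
  by congr g; congr X; apply: val_inj.
- rewrite /insertion big1 // => k _; apply: insertion_kmap_eq0 => //.
  (* Either the receiving term is the identity, and then the inserted term has arity above two and
     vanishes, or the receiving term has arity at least two and vanishes. *)
  have : (n.+3 - k = 0 -> 2 < k)%N.
    by move/eqP; rewrite subn_eq0; apply: leq_trans.
  case: (n.+3 - k)%N => [/(_ erefl)|m _]; last by right; case: m.
  by case: (nat_of_ord k) => [|[|[|j]]] // _; left.
Qed.

(** The result again has the shape [sum012], so the formula can be iterated. The degree [q] stays
    free because it enters only through [0 * q]: it is 1 for [mu] and 0 for [N]. *)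
Lemma RN_bracket_idD q p a f g : Defs.symmetric_form E (sum012 a f g) ->
  RN_bracket E 0 q (sum012 p id (fun _ _ => 0)) (sum012 a f g) =
  sum012 (f p - a) (g p) g.
Proof.
move=> F_form; apply: functional_extensionality_dep => n; apply/funext => X.
rewrite /RN_bracket mul0r expr0z scale1r insertion_idD // insertion_into_idD //.
case: n X => [|[|[|n]]] X //=; last by rewrite subr0.
- by rewrite addrK.
- by rewrite mulr2n addrK.
Qed.

End LowArityForms.

(** * The Maurer-Cartan equation and the deformed structure *)

Lemma l2_deg0_sym (K : fieldType) (V : lmodType K) (E : int -> set V) c l1 l2 :
  curved_sdgla E c l1 l2 -> forall p j x, E 0 p -> E j x -> l2 x p = l2 p x.
Proof.
by move=> mu p j x pE xE; rewrite (l2_sym mu xE pE) mulr0 expr0z scale1r.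
Qed.

Theorem proposition2p10 (R : realType) (K : fieldType)
    (hK : K = R :> fieldType \/ K = R[i] :> fieldType)
    (V : lmodType K) (E : int -> set V) (hE : grading E)
    (c : V) (l1 : V -> V) (l2 : V -> V -> V) (hmu : curved_sdgla E c l1 l2)
    (p : V) (hp : E 0 p) :
  let mu := sum012 c l1 l2 in
  let N := sum012 p id (fun _ _ => 0) in
  ((nijenhuis E N mu N /\ curvature N = p) <-> maurer_cartan c l1 l2 p) /\
  (maurer_cartan c l1 l2 p ->
     RN_bracket E 0 1 N mu = sum012 (l1 p - c) (l2 p) l2 /\
     curved_sdgla E (l1 p - c) (l2 p) l2).
Proof.
move=> mu N.
(* Characteristic zero allows division by 2 in the Maurer-Cartan equation and by 3 in the Jacobi
   identity at [p, p, p]. *)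
have char0 n : n.+1%:R != 0 :> K.
  have charR : n.+1%:R != 0 :> R by rewrite pnatr_eq0.
  have charC : n.+1%:R != 0 :> R[i] by rewrite pnatr_eq0.
  by case: hK => ->.
have p_sym := l2_deg0_sym hmu hp.
have [cE l1_lin l1E l2_linl l2_linr l2E l2s l1c l1l1 l1l2 jac] := hmu.
have mu_form : Defs.symmetric_form E mu by apply: sum012_symmetric_form.
have mu'_form : Defs.symmetric_form E (sum012 (l1 p - c) (l2 p) l2).
  by apply: sum012_symmetric_form.
have N_form : Defs.symmetric_form E N := sum012_idD_symmetric_form E p.
have Nmu : RN_bracket E 0 1 N mu = sum012 (l1 p - c) (l2 p) l2.
  exact: RN_bracket_idD.
have NNmu : RN_bracket E 0 1 N (sum012 (l1 p - c) (l2 p) l2) =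
    sum012 (l2 p p - (l1 p - c)) (l2 p) l2.
  exact: RN_bracket_idD.
have NN : RN_bracket E 0 0 N N = zero_form.
  rewrite RN_bracket_idD //; apply: functional_extensionality_dep => n.
  apply/funext => X; case: n X => [|[|[|n]]] X //=.
  by rewrite subrr.
have MC : maurer_cartan c l1 l2 p <-> l2 p p = (l1 p - c) *+ 2.
  rewrite /maurer_cartan -(scaler_nat 2 (l1 p - c)).
  split => [/eqP|->].
    by rewrite subr_eq0 => /eqP ->; rewrite scalerA divff ?scale1r.
  by rewrite scalerA mulVf ?scale1r ?subrr.
split; last move=> /MC ppE; last split=> //.
  split=> [[[_ _ _ NNmuE _] _]|/MC ppE].
    (* Only the arity 0 terms of the two brackets can differ. *)
    apply/MC; have := congr1 (fun F : formal_sum V => F 0 (fun=> 0)) NNmuE.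
    by rewrite Nmu NNmu /= => /eqP; rewrite subr_eq -mulr2n => /eqP.
  split=> //; split=> //.
  - by split=> //; apply: sum012_degree.
  - split=> //; apply: sum012_degree => // [i x xE|i j x y _ _].
      by rewrite addr0.
    exact: graded0.
  - split=> //; apply: sum012_degree => // [i x xE|i j x y _ _].
      by rewrite addr0.
    exact: graded0.
  - by rewrite Nmu NNmu ppE mulr2n addrK.
have mcE : l1 p - c = 2^-1 *: l2 p p.
  by rewrite ppE -(scaler_nat 2 (l1 p - c)) scalerA mulVf ?scale1r.
have ppdeg : E 1 (l2 p p) by have := l2E _ _ _ _ hp hp.
have l2Zl a x y : l2 (a *: x) y = a *: l2 x y.
  exact: GRing.scalable_linear (l2_linl y) a x.
have l2Zr a x y : l2 x (a *: y) = a *: l2 x y.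
  exact: GRing.scalable_linear (l2_linr x) a y.
split=> //.
- by rewrite mcE -(addr0 (_ *: _)); apply: (gradedZD hE) => //; apply: graded0.
- by move=> i x xE; rewrite -(add0r i); apply: l2E.
(* All signs are 1 in degree 0, so Jacobi at [p, p, p] says that three times [l2 (l2 p p) p]
   vanishes. *)
- have := jac _ _ _ _ _ _ hp hp hp.
  rewrite !mul0r !expr0z !scale1r -mulr2n -mulrSr => /eqP.
  rewrite -scaler_nat scaler_eq0 (negPf (char0 2)) /= => /eqP ppp0.
  by rewrite mcE l2Zr -(p_sym _ _ ppdeg) ppp0 scaler0.
(* Jacobi at [p, p, x] gives [l2 (l2 p p) x = - 2 l2 p (l2 p x)]; the factor [2^-1] of the new
   curvature cancels the 2. *)
- move=> i x xE; rewrite mcE l2Zl.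
  have pxE := l2E _ _ _ _ hp xE.
  have := jac _ _ _ _ _ _ hp hp xE.
  rewrite !mul0r !expr0z !scale1r (p_sym _ _ pxE) -addrA -mulr2n => /eqP.
  rewrite addr_eq0 => /eqP ->.
  by rewrite scalerN -scaler_nat scalerA mulVf ?scale1r ?addNr.
(* This is Jacobi at [p, x, y]: swapping [x] with [l2 p y], of degree [j + 1], costs the sign of
   exponent [i * (j + 1)], which together with that of exponent [i] leaves exponent [i * j]. *)
- move=> i j x y xE yE.
  have xyE := l2E _ _ _ _ xE yE.
  have pyE := l2E _ _ _ _ hp yE.
  have := jac _ _ _ _ _ _ hp xE yE.
  rewrite mul0r expr0z scale1r (p_sym _ _ xyE) => <-.
  rewrite (l2s _ _ _ _ xE pyE) scalerA add0r mulrDr mulr1.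
  rewrite expfzDr ?oppr_eq0 ?oner_eq0 // mulrCA signz_sqr mulr1.
  by rewrite [RHS]addrC addrA.
Qed.
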